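(* For every integer $r\ge 1$, $$\dim \mathcal{Y}_r\Lambda^0=\tfrac16\left(r^3+6r^2+23r\right)\ \le\ \tfrac16\left(2r^3+9r^2+13r+6\right)=\dim\mathcal{Y}^-_r\Lambda^0,$$ and the inequality is strict for every $r>1$.
   Context: The dimension of a finite element family means the dimension of its space of shape functions: $\dim\mathcal{Y}^-_r\Lambda^0=\dim\phi\left(\mathcal{Q}^{[r,r]}_r\right)$ and $\dim\mathcal{Y}_r\Lambda^0=\dim\phi\left(\mathcal{S}^{[r,r]}_r\right)$, defined as follows. The infinite pyramid is $K_\infty=\{(x,y,z): 0\le x,y\le 1,\ 0\le z\le\infty\}$, where all points $(x,y,\infty)$ are identified to a single point. The reference pyramid is $\hat K=\{(\xi,\eta,\zeta)\in\mathbb{R}^3: 0\le \xi,\eta,\zeta,\ \xi\le 1-\zeta,\ \eta\le 1-\zeta\}$. The bijection $\phi:K_\infty\to\hat K$ is $\phi(x,y,z)=\left(\frac{x}{1+z},\frac{y}{1+z},\frac{z}{1+z}\right)$ for $0\le z<\infty$, and $\phi(x,y,\infty)=(0,0,1)$. For a space $W$ of real functions on $K_\infty$, put $\phi(W)=\{u:\hat K\to\mathbb{R} : u\circ\phi\in W\}$. For a monomial $x^ay^b$, the superlinear degree $\mathrm{sldeg}(x^ay^b)$ is the sum of those exponents among $a,b$ that are different from $1$. The spaces of functions on $K_\infty$ are (with $a,b,c$ integers) $$\mathcal{Q}^{[r,r]}_r=\mathrm{span}\left\{\tfrac{x^ay^b}{(1+z)^c}: 0\le a,b\le c\le r\right\},$$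 $$\mathcal{S}^{[r,r]}_r=\mathrm{span}\left\{\tfrac{x^ay^b}{(1+z)^c}: 0\le a,b\le c\le r,\ \mathrm{sldeg}(x^ay^b)\le c\right\},$$ where each function $\frac{x^ay^b}{(1+z)^c}$ with $0\le a,b\le c$ is extended to $z=\infty$ by its limit (0 if $c>0$, and 1 if $a=b=c=0$). *)

(* Defs.v *)
From HB Require Import structures.
From mathcomp Require Import all_boot all_order all_algebra.
From mathcomp Require Import all_classical all_reals.
From mathcomp Require Import ring lra.

Set Implicit Arguments.
Unset Strict Implicit.
Unset Printing Implicit Defensive.

Import Order.TTheory GRing.Theory Num.Theory.

Local Open Scope classical_set_scope.
Local Open Scope ring_scope.

Section Dimension.
Variables (R : fieldType) (V : lmodType R).

Definition lspan (S : set V) : set V :=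
  [set v | exists (n : nat) (c : 'I_n -> R) (b : 'I_n -> V),
     (forall i, S (b i)) /\ v = \sum_(i < n) c i *: b i].

Definition lin_indep (n : nat) (b : 'I_n -> V) : Prop :=
  forall c : 'I_n -> R, \sum_(i < n) c i *: b i = 0 -> forall i, c i = 0.

Definition is_basis (W : set V) (n : nat) (b : 'I_n -> V) : Prop :=
  lin_indep b /\ lspan (range b) = W.

Definition has_dim (W : set V) (n : nat) : Prop :=
  exists b : 'I_n -> V, is_basis W b.

(* The default value 0 is also returned when W has no finite basis; see
   [lin_dimE] and [lin_dim_gt0]. *)
Definition lin_dim (W : set V) : nat := xget 0%N [set n | has_dim W n].

Lemma lspan_rangeP (n : nat) (b : 'I_n -> V) (v : V) :
  lspan (range b) v -> exists c : 'I_n -> R, v = \sum_(i < n) c i *: b i.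
Proof.
move=> [m [c [d [dS ->]]]].
have /choice[f fE] : forall i, exists j, b j = d i.
  by move=> i; have [j _ <-] := dS i; exists j.
exists (fun j => \sum_(i < m | f i == j) c i).
rewrite (partition_big f xpredT) //=; apply: eq_bigr => j _.
by rewrite scaler_suml; apply: eq_bigr => i /eqP <-; rewrite fE.
Qed.

Lemma mem_lspan (S : set V) (v : V) : S v -> lspan S v.
Proof.
move=> Sv; exists 1%N, (fun=> 1), (fun=> v); split=> //.
by rewrite big_ord1 scale1r.
Qed.

Lemma has_dim_le (W : set V) (m n : nat) :
  has_dim W m -> has_dim W n -> (m <= n)%N.
Proof.
move=> [b [bfree bW]] [d [dfree dW]].
have /choice[A AE] : forall i, exists c : 'I_n -> R,
    b i = \sum_(j < n) c j *: d j.
  move=> i; apply: lspan_rangeP; rewrite dW -bW.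
  by apply: mem_lspan; exists i.
pose M : 'M[R]_(m, n) := \matrix_(i, j) A i j.
suff /eqP <- : row_free M by exact: rank_leq_col.
apply/row_freeP.
have : kermx M = 0.
  apply/matrixP => k i; rewrite [RHS]mxE.
  apply: (bfree (fun i => kermx M k i)).
  have kM : forall j, \sum_i kermx M k i * A i j = 0.
    move=> j; have /matrixP/(_ k j) := mulmx_ker M.
    rewrite [LHS]mxE [RHS]mxE => kj; rewrite -[RHS]kj; apply: eq_bigr => l _.
    by congr (_ * _); rewrite mxE.
  under eq_bigr => l _ do rewrite AE scaler_sumr.
  rewrite exchange_big /= big1 // => j _.
  under eq_bigr => l _ do rewrite scalerA.
  by rewrite -scaler_suml kM scale0r.
by move/eqP; rewrite kermx_eq0 => /row_freeP.
Qed.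

Lemma lin_dimE (W : set V) (n : nat) : has_dim W n -> lin_dim W = n.
Proof.
move=> Wn; apply: xget_unique => // m Wm.
by apply/eqP; rewrite eqn_leq !(@has_dim_le W).
Qed.

Lemma lin_dim_gt0 (W : set V) : (0 < lin_dim W)%N -> has_dim W (lin_dim W).
Proof. by rewrite /lin_dim; case: xgetP => // n ->. Qed.

End Dimension.

Section Pyramid.
Variable R : realType.

Definition in_column (p : R * R * R) : bool :=
  let: (x, y, z) := p in [&& 0 <= x <= 1, 0 <= y <= 1 & 0 <= z].

(* [Some p] is a point with z < oo; [None] is the single point to which all the
   points (x, y, oo) are identified. *)
Definition K_infty : Type := option {p : R * R * R | in_column p}.

Definition in_pyramid (p : R * R * R) : bool :=
  let: (xi, eta, zeta) := p in
  [&& 0 <= xi, 0 <= eta, 0 <= zeta, xi <= 1 - zeta & eta <= 1 - zeta].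

Definition K_hat : Type := {p : R * R * R | in_pyramid p}.

Definition phi_coord (q : K_infty) : R * R * R :=
  match q with
  | Some p => let: (x, y, z) := sval p in
              (x / (1 + z), y / (1 + z), z / (1 + z))
  | None => (0, 0, 1)
  end.

Lemma phi_coord_in_pyramid (q : K_infty) : in_pyramid (phi_coord q).
Proof.
case: q => [[[[x y] z] /= /and3P[/andP[x0 x1] /andP[y0 y1] z0]]|] /=; last first.
  by rewrite lexx ler01 subrr lexx.
have z1 : 0 < 1 + z by lra.
have -> : 1 - z / (1 + z) = 1 / (1 + z) by field; rewrite gt_eqF.
by rewrite !ler_pM2r ?invr_gt0// !divr_ge0 ?x1 ?y1 // ltW.
Qed.

Definition phi (q : K_infty) : K_hat :=
  exist _ (phi_coord q) (phi_coord_in_pyramid q).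

Lemma phi_bij : bijective phi.
Proof.
have inj : injective phi.
  have top (p : {p : R * R * R | in_column p}) : phi_coord (Some p) <> (0, 0, 1).
    case: p => [[[x y] z] /= /and3P[_ _ z0]] [_ _ ez].
    have z1 : 1 + z != 0 by rewrite gt_eqF//; lra.
    by have := divfK z1 z; rewrite ez; lra.
  move=> [p|] [q|] // E; have pq := congr1 sval E; rewrite /= in pq; last 2 first.
  - by case: (top p).
  - by case: (top q).
  move: p q pq {E} => [[[x y] z] Hp] [[[x' y'] z'] Hq] [ex ey ez].
  have /and3P[_ _ z0] := Hp; have /and3P[_ _ z0'] := Hq.
  have n1 : 1 + z != 0 by rewrite gt_eqF//; lra.
  have n2 : 1 + z' != 0 by rewrite gt_eqF//; lra.
  have zz : z = z' by move/eqP: ez; rewrite eqr_div// => /eqP; lra.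
  rewrite -zz in ex ey n2.
  have xx : x = x' by apply: (mulIf (invr_neq0 n1)).
  have yy : y = y' by apply: (mulIf (invr_neq0 n1)).
  by congr Some; apply/val_inj; rewrite /= xx yy zz.
have surj : forall p : K_hat, exists q, phi q = p.
  move=> [[[x y] z] Hp]; have /and5P[x0 y0 z0 xz yz] := Hp.
  have [z1|z1] := eqVneq z 1.
    exists None; apply/val_inj => /=; rewrite z1.
    by congr (_, _, _); lra.
  have z1' : 0 < 1 - z by move: z1; rewrite neq_lt => /orP[]; lra.
  have Hq : in_column (x / (1 - z), y / (1 - z), z / (1 - z)).
    by rewrite /= !divr_ge0 ?(ltW z1')// !ler_pdivrMr// !mul1r xz yz.
  exists (Some (exist (fun p => is_true (in_column p)) _ Hq)); apply/val_inj => /=.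
  have n1 : 1 - z != 0 by rewrite gt_eqF.
  have n2 : 1 + z / (1 - z) = (1 - z)^-1 by field.
  by rewrite n2 !invrK !divfK.
have [g gE] := choice surj.
by exists g => // q; apply: inj; rewrite gE.
Qed.

(* R^o makes the functions into a vector space over R. *)
Definition phi_img (W : set (K_infty -> R^o)) : set (K_hat -> R^o) :=
  [set u : K_hat -> R^o | W (u \o phi)].

(* The value at [None] is the limit as z -> oo when a <= c and b <= c. *)
Definition Kmonomial (a b c : nat) : K_infty -> R^o := fun q =>
  match q with
  | Some p => let: (x, y, z) := sval p in x ^+ a * y ^+ b / (1 + z) ^+ c
  | None => (c == 0%N)%:R
  end.

Definition sldeg (a b : nat) : nat := (\sum_(e <- [:: a; b] | e != 1) e)%N.

Definition Q_space (r : nat) : set (K_infty -> R^o) :=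
  lspan [set u | exists a b c : nat,
    [/\ (a <= c)%N, (b <= c)%N, (c <= r)%N & u = Kmonomial a b c]].

Definition S_space (r : nat) : set (K_infty -> R^o) :=
  lspan [set u | exists a b c : nat,
    [/\ (a <= c)%N, (b <= c)%N, (c <= r)%N, (sldeg a b <= c)%N
      & u = Kmonomial a b c]].

Definition Yminus_Lambda0 (r : nat) : set (K_hat -> R^o) := phi_img (Q_space r).

Definition Y_Lambda0 (r : nat) : set (K_hat -> R^o) := phi_img (S_space r).

End Pyramid.

Arguments Q_space R r : clear implicits.
Arguments S_space R r : clear implicits.
Arguments Yminus_Lambda0 R r : clear implicits.
Arguments Y_Lambda0 R r : clear implicits.

(* Main.v *)
Require Import Defs.
From mathcomp Require Import all_boot all_order all_algebra.
From mathcomp Require Import all_classical all_reals.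
From mathcomp Require Import zify ring lra.

Import Order.TTheory GRing.Theory Num.Theory.
Local Open Scope ring_scope.

(** Substituting t = 1/(1+z), which ranges over (0, 1], turns x^a y^b / (1+z)^c
    into the monomial x^a y^b t^c on a cube, so these functions are linearly
    independent, and precomposition with the bijection phi preserves dimension.
    Both dimensions are thus numbers of triples (a, b, c).  For fixed c there are
    (c+1)^2 pairs (a, b) in the Q case; in the S case there are (c^2+3c+6)/2 for
    c >= 2, but only 1 and 4 for c = 0 and c = 1.  Finally, six times the
    difference of the dimensions is (r-1)(r^2+4r-6). *)

(** The polynomial with coefficients [f] has size at most [n] and vanishes at the [n] distinct
    points 1/(k+1), k < n, of (0, 1]. *)
Lemma powers_free (R : realFieldType) (n : nat) (f : 'I_n -> R) :
  (forall t : R, 0 < t <= 1 -> \sum_(i < n) f i * t ^+ i = 0) ->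
  forall i, f i = 0.
Proof.
move=> f0 i; pose p := rVpoly (\row_j f j).
suff p0 : p = 0 by have := coef_rVpoly_ord (\row_j f j) i; rewrite -/p p0 coef0 mxE.
pose rs : seq R := [seq k.+1%:R^-1 | k <- iota 0 n].
apply: (@roots_geq_poly_eq0 _ p rs); last by rewrite size_map size_iota size_poly.
  apply/allP => _ /mapP[k _ ->]; rewrite /root horner_poly.
  apply/eqP; rewrite -[RHS](f0 k.+1%:R^-1).
    by apply: eq_bigr => j _; rewrite valK mxE.
  by rewrite invr_gt0 ltr0Sn invf_le1 ?ltr0Sn// ler1n.
rewrite map_inj_uniq ?iota_uniq// => k l /invr_inj/eqP.
by rewrite eqr_nat => /eqP[].
Qed.

Lemma has_dim_lspan_free (R : fieldType) (V : lmodType R) (I : finType)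
    (e : I -> V) (P : pred I) :
  (forall c : I -> R, \sum_i c i *: e i = 0 -> forall i, c i = 0) ->
  has_dim (lspan [set v | exists2 i, P i & v = e i]) #|P|.
Proof.
move=> e_free; exists (fun j => e (enum_val j)); split.
  move=> c c0 j.
  (* Extend [c] by zero outside [P]: [enum_val] is injective, so each inner sum has at most one
     term. *)
  have := e_free (fun i => \sum_(k : 'I_#|P| | enum_val k == i) c k).
  have -> : \sum_i (\sum_(k : 'I_#|P| | enum_val k == i) c k) *: e i = 0.
    rewrite -[RHS]c0 (partition_big (@enum_val _ P) xpredT) //=.
    apply: eq_bigr => i _; rewrite scaler_suml.
    by apply: eq_bigr => k /eqP ->.
  move=> /(_ erefl (enum_val j)); rewrite (big_pred1 j) // => k.
  exact: (inj_eq enum_val_inj).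
congr lspan; apply/seteqP; split=> [_ [j _ <-]|_ [i Pi ->]] /=.
  by exists (enum_val j) => //; exact: (enum_valP j).
by exists (enum_rank_in (A := P) Pi i) => //; rewrite enum_rankK_in.
Qed.

(** With [g] inverse to [f], a basis [b] of [W] is carried to the functions [b i \o g]. *)
Lemma has_dim_precomp (R : fieldType) (X Y : Type) (f : X -> Y)
    (W : set (X -> R^o)) (n : nat) :
  bijective f -> has_dim W n -> has_dim [set u : Y -> R^o | W (u \o f)] n.
Proof.
move=> [g fK gK] [b [bfree bW]].
have sumE T (c : 'I_n -> R) (h : 'I_n -> T -> R^o) x :
    (\sum_i c i *: h i) x = \sum_i c i * h i x by rewrite fct_sumE.
exists (fun i => b i \o g); split.
  move=> c c0; apply: bfree; apply/funext => x.
  by have := congr1 (fun u => u (f x)) c0; rewrite !sumE /= fK.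
apply/seteqP; split=> u /=.
  move=> /lspan_rangeP[c ->]; rewrite -bW; exists n, c, b.
  split=> [i|]; first by exists i.
  by apply/funext => x /=; rewrite !sumE /= fK.
rewrite -bW => /lspan_rangeP[c uE]; exists n, c, (fun i => b i \o g).
split=> [i|]; first by exists i.
by apply/funext => y; have := congr1 (fun v => v (g y)) uE; rewrite !sumE /= gK.
Qed.

Lemma Kmonomial_eval_exists (R : realType) (x y t : R) :
  0 < x <= 1 -> 0 < y <= 1 -> 0 < t <= 1 ->
  exists q : K_infty R, forall a b c,
    @Kmonomial R a b c q = x ^+ a * y ^+ b * t ^+ c.
Proof.
move=> /andP[x0 x1] /andP[y0 y1] /andP[t0 t1].
have Hp : in_column (x, y, t^-1 - 1).
  by rewrite /= x1 y1 (ltW x0) (ltW y0) subr_ge0 invf_ge1.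
exists (Some (exist (fun p => is_true (in_column p)) _ Hp)) => a b c /=.
by rewrite addrC subrK -exprVn invrK.
Qed.

(** Evaluated on the cube, the combination is a polynomial in x whose coefficients are polynomials
    in y with coefficients polynomial in t, so [powers_free] applies once per variable. *)
Lemma Kmonomial_free (R : realType) (n : nat) (k : 'I_n * 'I_n * 'I_n -> R) :
  \sum_i k i *: @Kmonomial R i.1.1 i.1.2 i.2 = 0 -> forall i, k i = 0.
Proof.
move=> k0 [[a b] c].
have {}k0 (x y t : R) : 0 < x <= 1 -> 0 < y <= 1 -> 0 < t <= 1 ->
    \sum_a (\sum_b (\sum_c k (a, b, c) * t ^+ c) * y ^+ b) * x ^+ a = 0.
  move=> xP yP tP; have [q qE] := Kmonomial_eval_exists R x y t xP yP tP.
  rewrite -[RHS](congr1 (fun u => u q) k0) fct_sumE.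
  under eq_bigr do rewrite mulr_suml.
  rewrite pair_bigA; under eq_bigr do rewrite !mulr_suml.
  rewrite pair_bigA /=; apply: eq_bigr => -[[i j] l] _ /=.
  by rewrite -[RHS]/(_ * @Kmonomial R i j l q) qE; ring.
apply: (powers_free R n (fun c => k (a, b, c))) => t tP.
apply: (powers_free R n (fun b => \sum_c k (a, b, c) * t ^+ c)) => y yP.
apply: (powers_free R n (fun a => \sum_b (\sum_c k (a, b, c) * t ^+ c) * y ^+ b)).
by move=> x xP; exact: k0.
Qed.

(** The bounds on [P] place every admissible triple in the finite cube
    ['I_r.+1 * 'I_r.+1 * 'I_r.+1], where the monomials form a free family. *)
Lemma lin_dim_Kmonomials (R : realType) (r : nat) (P : nat -> nat -> nat -> bool) :
  (forall a b c, P a b c -> [&& a <= c, b <= c & c <= r]%N) ->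
  lin_dim (@phi_img R (lspan [set u | exists a b c, P a b c /\ u = @Kmonomial R a b c]))
  = (\sum_(c < r.+1) \sum_(a < c.+1) \sum_(b < c.+1) P a b c)%N.
Proof.
move=> Pr; pose P' (i : 'I_r.+1 * 'I_r.+1 * 'I_r.+1) := P i.1.1 i.1.2 i.2.
have -> : [set u | exists a b c, P a b c /\ u = @Kmonomial R a b c]%classic
        = [set u | exists2 i, P' i & u = @Kmonomial R i.1.1 i.1.2 i.2]%classic.
  apply/seteqP; split=> [_ [a [b [c [Pabc ->]]]]|_ [i Pi ->]] /=; last first.
    by exists i.1.1, i.1.2, i.2.
  have /and3P[ac bc cr] := Pr _ _ _ Pabc.
  have ar := leq_trans ac cr; have br := leq_trans bc cr.
  by exists (inord a, inord b, inord c); rewrite /P' /= !inordK.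
(* A basis is exhibited here, so [lin_dim] is the true dimension and not its default value 0. *)
have -> := lin_dimE (has_dim_precomp _ _ _ _ _ _ (@phi_bij R)
  (has_dim_lspan_free _ _ _ _ P' (Kmonomial_free R r.+1))).
transitivity (\sum_(i : 'I_r.+1 * 'I_r.+1 * 'I_r.+1) P' i)%N.
  by rewrite -sum1_card big_mkcond.
rewrite -(pair_bigA _ (fun i j => P' (i, j) : nat)) /= exchange_big /=.
apply: eq_bigr => c _.
rewrite -(pair_bigA _ (fun i j => P' (i, j, c) : nat)) /=.
(* Widen the ranges of a and b from c to r; the added terms vanish because [P] forces a, b <= c. *)
have cr : (c.+1 <= r.+1)%N by [].
rewrite [RHS](big_ord_widen _ (fun a => \sum_(b < c.+1) P a b c)%N cr) [RHS]big_mkcond /=.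
apply: eq_bigr => a _.
rewrite (big_ord_widen _ (fun b => P a b c : nat) cr) [X in if _ then X else _]big_mkcond /=.
have [ac|ac] := ifPn.
  apply: eq_bigr => b _; rewrite /P' /=; case: ifPn => // bc.
  by case: (boolP (P a b c)) => // /Pr/and3P[_ ? _]; rewrite ltnS in bc; case/negP: bc.
rewrite big1 // => b _; rewrite /P' /=.
by case: (boolP (P a b c)) => // /Pr/and3P[? _ _]; rewrite ltnS in ac; case/negP: ac.
Qed.

Lemma sldegE (a b : nat) : sldeg a b = ((a != 1) * a + (b != 1) * b)%N.
Proof. by rewrite /sldeg !big_cons big_nil; do 2!case: eqP => _ /=; lia. Qed.

Lemma sum_ltn (n m : nat) : (m <= n -> \sum_(b < n) (b < m) = m)%N.
Proof.
by move=> mn; rewrite -big_mkcond -(big_ord_widen n (fun=> 1%N) mn) sum1_card card_ord.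
Qed.

(** Put d = c+2. Rows a = 0 and a = 1 admit every b <= d. A row a >= 2 admits b = 1 and all b <= d -
    a; the value b = 1 is new only if a = d. *)
Lemma sum_sldeg_le (c : nat) :
  (\sum_(a < c.+3) \sum_(b < c.+3) (sldeg a b <= c.+2)).*2 = (c.+2 * c.+2 + 3 * c.+2 + 6)%N.
Proof.
have row a : (a <= c.+2)%N -> (\sum_(b < c.+3) (sldeg a b <= c.+2) =
    if a <= 1 then c.+3 else c.+3 - a + (a == c.+2))%N.
  move=> ac; case: ifPn => a1.
    rewrite -[RHS]card_ord -sum1_card; apply: eq_bigr => b _.
    by have := ltn_ord b; rewrite sldegE; case: a a1 {ac} => [|[]] //= _; case: eqP; lia.
  transitivity (\sum_(b < c.+3) ((b < c.+3 - a) + ((b : nat) == 1) * (a == c.+2)))%N.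
    by apply: eq_bigr => b _; rewrite sldegE; have := ltn_ord b; do !case: eqP; lia.
  rewrite big_split /= sum_ltn ?leq_subr// -big_distrl /=; congr (_ + _)%N.
  by rewrite 2!big_ord_recl /= big1 // mul1n.
under eq_bigr => a _ do rewrite row -1?ltnS ?ltn_ord //.
rewrite 2!big_ord_recl /=.
(* Shift to a = i + 2; the final 1 is the extra pair (d, 1). *)
have -> : (\sum_(i < c.+1) (if bump 0 (bump 0 i) <= 1 then c.+3
    else c.+3 - bump 0 (bump 0 i) + (bump 0 (bump 0 i) == c.+2)) =
   \sum_(i < c.+1) (c.+1 - i) + 1)%N.
  rewrite big_ord_recr [in RHS]big_ord_recr /= -addnA; congr (_ + _)%N.
    by apply: eq_bigr => i _; have := ltn_ord i; rewrite /bump; lia.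
  by rewrite /bump; lia.
have gauss n : ((\sum_(i < n) (n - i)).*2 = n * n.+1)%N.
  elim: n => [|n IHn]; first by rewrite big_ord0.
  rewrite big_ord_recl /=.
  under eq_bigr do rewrite /bump /= add1n subSS.
  by rewrite doubleD IHn; lia.
by have := gauss c.+1; lia.
Qed.

Lemma lin_dim_Y_Lambda0 (R : realType) (r : nat) : (1 <= r)%N ->
  (6 * lin_dim (Y_Lambda0 R r) = r ^ 3 + 6 * r ^ 2 + 23 * r)%N.
Proof.
move=> r1.
pose P a b c := [&& a <= c, b <= c, c <= r & sldeg a b <= c]%N.
have -> : Y_Lambda0 R r =
    @phi_img R (lspan [set u | exists a b c, P a b c /\ u = @Kmonomial R a b c]).
  congr (@phi_img R (lspan _)); apply/seteqP; split=> u [a [b [c]]].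
    by move=> [ac bc cr s ->]; exists a, b, c; rewrite /P ac bc cr s.
  by move=> [/and4P[? ? ? ?] ->]; exists a, b, c.
rewrite (lin_dim_Kmonomials R r) => [|a b c /and4P[-> -> -> _]] //.
under eq_bigr => c _ do under eq_bigr => a _ do under eq_bigr => b _ do
  rewrite /P -!(ltnS _ c) !ltn_ord -ltnS ltn_ord /= ltnS.
(* The induction starts at r = 1, where the count is 1 + 4 = 5; at r = 0 the dimension is 1 but the
   formula gives 0. Each later layer has c >= 2, as [sum_sldeg_le] requires. *)
elim: r r1 {P} => [//|[|r] IHr] _.
  by rewrite !big_ord_recl !big_ord0 /= !sldegE.
rewrite big_ord_recr /= mulnDr IHr //.
have := sum_sldeg_le r; set S := (\sum_(_ < _) _)%N; move: S => S SE.
have -> : (6 * S = 3 * S.*2)%N by lia.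
by rewrite SE !expnS expn0; lia.
Qed.

Lemma lin_dim_Yminus_Lambda0 (R : realType) (r : nat) :
  (6 * lin_dim (Yminus_Lambda0 R r) = 2 * r ^ 3 + 9 * r ^ 2 + 13 * r + 6)%N.
Proof.
pose P a b c := [&& a <= c, b <= c & c <= r]%N.
have -> : Yminus_Lambda0 R r =
    @phi_img R (lspan [set u | exists a b c, P a b c /\ u = @Kmonomial R a b c]).
  congr (@phi_img R (lspan _)); apply/seteqP; split=> u [a [b [c]]].
    by move=> [ac bc cr ->]; exists a, b, c; rewrite /P ac bc cr.
  by move=> [/and3P[? ? ?] ->]; exists a, b, c.
rewrite (lin_dim_Kmonomials R r) //.
under eq_bigr => c _ do under eq_bigr => a _ do under eq_bigr => b _ do
  rewrite /P -!(ltnS _ c) !ltn_ord -ltnS ltn_ord /=.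
under eq_bigr => c _ do rewrite !sum_nat_const !card_ord muln1.
elim: r {P} => [|r IHr]; first by rewrite big_ord_recl big_ord0.
by rewrite big_ord_recr /= mulnDr IHr !expnS expn0; lia.
Qed.

Theorem mainTheorem3 (R : realType) (r : nat) (hr : (1 <= r)%N) :
  let s : rat := 1 / 6 * (r%:R ^+ 3 + 6 * r%:R ^+ 2 + 23 * r%:R) in
  let q : rat := 1 / 6 * (2 * r%:R ^+ 3 + 9 * r%:R ^+ 2 + 13 * r%:R + 6) in
  [/\ (lin_dim (Y_Lambda0 R r))%:R = s,
      s <= q,
      q = (lin_dim (Yminus_Lambda0 R r))%:R
    & (1 < r)%N -> s < q].
Proof.
move=> s q.
have sE : (lin_dim (Y_Lambda0 R r))%:R = s.
  have /(congr1 (fun n => n%:R : rat)) := lin_dim_Y_Lambda0 R r hr.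
  by rewrite !(natrX, natrM, natrD) /s => <-; field.
have qE : q = (lin_dim (Yminus_Lambda0 R r))%:R.
  have /(congr1 (fun n => n%:R : rat)) := lin_dim_Yminus_Lambda0 R r.
  by rewrite !(natrX, natrM, natrD) /q => <-; field.
have qsE : q - s = 1 / 6 * ((r%:R - 1) * (r%:R ^+ 2 + 4 * r%:R - 6)).
  by rewrite /q /s; field.
have lt_sq : (1 < r)%N -> s < q.
  move=> r1; have r2 : 2 <= r%:R :> rat by rewrite ler_nat.
  (* For r >= 2 the quadratic factor is at least 6. *)
  by rewrite -subr_gt0 qsE !mulr_gt0 //; nra.
(* In the remaining case r = 1 the factor r - 1 vanishes and the two sides agree. *)
split=> //; have := hr; rewrite leq_eqVlt => /orP[/eqP r1|/lt_sq/ltW//].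
by rewrite -subr_ge0 qsE -r1 subrr mul0r mulr0.
Qed.
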